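(* Let $b\mid M$ with $b<M$, and let $C$ be the array code over $\mathbb{F}_q$ whose columns are associated with the elements of a $b$-spread of $\mathbb{F}_q^M$, each exactly once. Then $C$ has symbol locality $r_{\mathrm s}=2$ and node locality satisfying $2\le r_{\mathrm n}\le b+1$. Moreover, there exists a $b$-spread of $\mathbb{F}_q^M$ for which the resulting code has $r_{\mathrm n}\le M/b$.
   Context: $q$ is a prime power. A $b$-spread of $\mathbb{F}_q^M$ is a set of $b$-dimensional subspaces of $\mathbb{F}_q^M$ that pairwise intersect only in $\{\overline{0}\}$ and whose union is $\mathbb{F}_q^M$. Given $b$-dimensional subspaces $V_1,\dots,V_n$ of $\mathbb{F}_q^M$, the array code whose columns are associated with them is obtained by placing a basis of $V_j$ as columns $(j-1)b+1,\dots,jb$ (the $j$th thick column) of an $M\times bn$ matrix $G$ and taking all $b\times n$ arrays whose column-by-column flattening lies in the row space of $G$. A set $S\subseteq[n]\setminus\{j\}$ is a recovery set for codeword column $j$ if each entry of column $j$ is a fixed $\mathbb{F}_q$-linear combination of the entries in columns indexed by $S$, valid for all codewords (equivalently $V_j\subseteq\sum_{k\in S}V_k$); it is a recovery set for symbol $(i,j)$ if $c_{i,j}$ alone is such a combination (equivalently the $i$th column of the $j$th thick column of $G$ lies in $\sum_{k\in S}V_k$). The node locality $r_{\mathrm n}$ (resp. symbol locality $r_{\mathrm s}$) is the smallest $r$ such that every codeword column (resp. symbol) has a recovery set of size at most $r$. *)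

(* Defs.v *)
From HB Require Import structures.
From mathcomp Require Import all_boot all_order all_algebra all_field.
Set Implicit Arguments. Unset Strict Implicit. Unset Printing Implicit Defensive.
Import GRing.Theory.
Local Open Scope ring_scope.

Section ArrayCodes.
Variables (F : finFieldType) (M b n : nat).

(* I.e. V enumerates a b-spread, each element exactly once. *)
Definition is_spread_family (V : 'I_n -> {vspace 'rV[F]_M}) : Prop :=
  [/\ forall j, \dim (V j) = b,
      forall i j, i != j -> (V i :&: V j = 0)%VS
    & forall v : 'rV[F]_M, exists j, v \in V j].

(* g j i = i-th column of the j-th thick column of the generator matrix G
   (i.e. i-th basis vector of V_j), written as a row vector of F^M. *)
Variable g : 'I_n -> 'I_b -> 'rV[F]_M.

(* The codeword (a b x n array) associated with message x : x *m G, reshaped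
   column by column. The code is the set of all such arrays. *)
Definition codeword (x : 'rV[F]_M) : 'M[F]_(b, n) :=
  \matrix_(i < b, k < n) (x *m (g k i)^T) 0 0.

Definition symbol_recovery_set (S : {set 'I_n}) (i : 'I_b) (j : 'I_n) : Prop :=
  j \notin S /\
  exists a : 'I_b -> 'I_n -> F, forall x : 'rV[F]_M,
    codeword x i j = \sum_(k in S) \sum_(i' < b) a i' k * codeword x i' k.

Definition node_recovery_set (S : {set 'I_n}) (j : 'I_n) : Prop :=
  j \notin S /\
  exists a : 'I_b -> 'I_b -> 'I_n -> F, forall x : 'rV[F]_M, forall i : 'I_b,
    codeword x i j = \sum_(k in S) \sum_(i' < b) a i i' k * codeword x i' k.

Definition symbol_local (r : nat) : Prop :=
  forall (i : 'I_b) (j : 'I_n), exists S : {set 'I_n}, (#|S| <= r)%N /\ symbol_recovery_set S i j.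

Definition node_local (r : nat) : Prop :=
  forall j : 'I_n, exists S : {set 'I_n}, (#|S| <= r)%N /\ node_recovery_set S j.

Definition symbol_locality (r : nat) : Prop :=
  symbol_local r /\ forall r', symbol_local r' -> (r <= r')%N.

Definition node_locality (r : nat) : Prop :=
  node_local r /\ forall r', node_local r' -> (r <= r')%N.

End ArrayCodes.

(* Main.v *)
(* Columns S recover symbol (i, j) iff the i-th basis vector of V_j lies in the
   sum of the V_k, k in S, and recover column j iff V_j does.  Two distinct
   spread elements meet trivially, so one column never suffices.  Conversely,
   fix u outside V_j: each g in V_j is (g + u) - u, where g + u and u lie in
   spread elements other than V_j; this gives r_s <= 2, and r_n <= b + 1 by
   doing so for the b basis vectors of V_j with a common u.
   For M = m b, identify F^M with L^m where [L : F] = b; the L-lines form the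
   Desarguesian spread, and every L-line lies in the sum of m other L-lines
   (the coordinate lines, one of them tilted if it contains the given line),
   so r_n <= m = M / b. *)

Require Import Defs.
From HB Require Import structures.
From mathcomp Require Import all_boot all_order all_algebra all_field.
From Stdlib Require Import Classical_Prop Wf_nat.

Set Implicit Arguments.
Unset Strict Implicit.
Unset Printing Implicit Defensive.

Import GRing.Theory.
Local Open Scope ring_scope.

Section Localities.
Variables (F : finFieldType) (M b n : nat) (g : 'I_n -> 'I_b -> 'rV[F]_M).

Lemma codewordE x i k : codeword g x i k = (x *m (g k i)^T) 0 0.
Proof. exact: mxE. Qed.

Lemma node_local_symbol_local r : node_local g r -> symbol_local g r.
Proof.
move=> loc_g i j; have [S [leS [jS [a Ha]]]] := loc_g j.
by exists S; split => //; split => //; exists (a i).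
Qed.

Lemma ex_node_locality r : node_local g r -> exists2 rn, node_locality g rn & (rn <= r)%N.
Proof.
move=> loc_r.
have [rn [[loc_rn min_rn] _]] := dec_inh_nat_subset_has_unique_least_element
  (node_local g) (fun r => classic _) (ex_intro _ r loc_r).
exists rn; last exact/leP/min_rn.
by split=> // r' /min_rn /leP.
Qed.

End Localities.

Section RecoverySets.
Variables (F : finFieldType) (M b n : nat).
Variables (V : 'I_n -> {vspace 'rV[F]_M}) (B : 'I_n -> b.-tuple 'rV[F]_M).
Hypothesis basisB : forall j, basis_of (V j) (B j).
Let g j i := tnth (B j) i.

Lemma mem_sumv_recovery (S : {set 'I_n}) (v : 'rV[F]_M) :
  v \in (\sum_(k in S) V k)%VS <->
  exists a : 'I_b -> 'I_n -> F, forall x : 'rV[F]_M,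
    (x *m v^T) 0 0 = \sum_(k in S) \sum_(i < b) a i k * codeword g x i k.
Proof.
split=> [/memv_sumP[vs Vvs ->] | [a Ha]].
  exists (fun i k => coord (B k) i (vs k)) => x.
  rewrite linear_sum mulmx_sumr summxE; apply: eq_bigr => k Sk.
  have := Vvs k Sk; rewrite -(span_basis (basisB k)) => /coord_span {1}->.
  rewrite linear_sum mulmx_sumr summxE; apply: eq_bigr => i _.
  by rewrite linearZ -scalemxAr mxE codewordE /g (tnth_nth 0).
have -> : v = \sum_(k in S) \sum_(i < b) a i k *: g k i.
  apply/rowP => l; have := Ha (delta_mx 0 l); rewrite -rowE !mxE => ->.
  rewrite summxE; apply: eq_bigr => k _; rewrite summxE; apply: eq_bigr => i _.
  by rewrite codewordE -rowE !mxE.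
apply: memv_sumr => k _; apply: rpred_sum => i _; apply: memvZ.
exact: (basis_mem (basisB k)) (mem_tnth _ _).
Qed.

Lemma symbol_recovery_setP (S : {set 'I_n}) i j :
  symbol_recovery_set g S i j <-> j \notin S /\ g j i \in (\sum_(k in S) V k)%VS.
Proof.
rewrite mem_sumv_recovery; split=> -[jS [a Ha]]; split=> //; exists a => x.
  by rewrite -Ha codewordE.
by rewrite codewordE Ha.
Qed.

Lemma node_recovery_set_subv (S : {set 'I_n}) j :
  j \notin S -> (V j <= \sum_(k in S) V k)%VS -> node_recovery_set g S j.
Proof.
move=> jS /subvP sVjS; split=> //.
have Vg i : g j i \in (\sum_(k in S) V k)%VS.
  exact/sVjS/(basis_mem (basisB j))/mem_tnth.
have [a Ha] := fin_all_exists (fun i => proj1 (mem_sumv_recovery S _) (Vg i)).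
by exists a => x i; rewrite codewordE Ha.
Qed.

Lemma node_local_subv r :
  (forall j, exists S : {set 'I_n},
     [/\ j \notin S, (#|S| <= r)%N & (V j <= \sum_(k in S) V k)%VS]) ->
  node_local g r.
Proof.
move=> coverV j; have [S [jS leS sVS]] := coverV j.
by exists S; split=> //; apply: node_recovery_set_subv.
Qed.

End RecoverySets.

Section SpreadCodes.
Variables (F : finFieldType) (M b n : nat).
Variables (V : 'I_n -> {vspace 'rV[F]_M}) (B : 'I_n -> b.-tuple 'rV[F]_M).
Hypothesis basisB : forall j, basis_of (V j) (B j).
Hypothesis spreadV : is_spread_family b V.
Hypothesis ltn_bM : (b < M)%N.
Let g j i := tnth (B j) i.

Let g_neq0 j i : g j i != 0.
Proof. exact: free_not0 (basis_free (basisB j)) (mem_tnth i (B j)). Qed.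

Let g_in j i : g j i \in V j.
Proof. exact: (basis_mem (basisB j)) (mem_tnth i (B j)). Qed.

Let mem_sumv_spread (S : {set 'I_n}) k v :
  k \in S -> v \in V k -> v \in (\sum_(l in S) V l)%VS.
Proof. by move=> Sk; apply/subvP/(sumv_sup k). Qed.

Lemma spread_mem_eq0 j k v : j != k -> v \in V j -> v \in V k -> v = 0.
Proof.
case: spreadV => _ capV _ jk Vjv Vkv; apply/eqP.
by rewrite -memv0 -(capV _ _ jk) memv_cap Vjv Vkv.
Qed.

Lemma spread_notin j : exists u, u \notin V j.
Proof.
apply/existsP; apply: contraLR ltn_bM => /existsPn fullVj; rewrite -leqNgt.
have /dimvS : (fullv <= V j)%VS by apply/subvP => u _; exact/negPn/fullVj.
by case: spreadV => -> _ _; rewrite dimvf dim_matrix mul1r.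
Qed.

Lemma symbol_local_ge2 r : (0 < b)%N -> symbol_local g r -> (2 <= r)%N.
Proof.
move=> b_gt0 loc_r; rewrite leqNgt; apply/negP => r_le1.
have [j _] : exists j, (0 : 'rV[F]_M) \in V j by case: spreadV.
have [S [leS /(symbol_recovery_setP basisB)[jS gS]]] := loc_r (Ordinal b_gt0) j.
have : (#|S| <= 1)%N by apply: leq_trans leS _.
rewrite leq_eqVlt ltnS leqn0 cards_eq0 => /orP[/cards1P[k Sk]|/eqP S0]; last first.
  by move: gS; rewrite S0 big_set0 memv0 (negPf (g_neq0 _ _)).
move: gS jS; rewrite Sk big_set1 in_set1 => gk jk.
by have := g_neq0 j (Ordinal b_gt0); rewrite (spread_mem_eq0 jk (g_in _ _) gk) eqxx.
Qed.

Lemma symbol_local2 : symbol_local g 2.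
Proof.
case: spreadV => _ _ coverV i j.
have [u Vj'u] := spread_notin j; have [k Vku] := coverV u.
have [l Vl_gu] := coverV (g j i - u).
have Vj'gu : g j i - u \notin V j by rewrite rpredBl ?g_in.
exists [set k; l]; split; first by rewrite cards2; case: (k != l).
apply/(symbol_recovery_setP basisB); split.
  rewrite in_set2; apply/norP; split.
    by apply: contraNneq Vj'u => ->.
  by apply: contraNneq Vj'gu => jl; rewrite [in V j]jl.
rewrite -[tnth _ _](subrK u) addrC.
by apply: rpredD; [apply: (mem_sumv_spread _ Vku) | apply: (mem_sumv_spread _ Vl_gu)];
  rewrite !inE eqxx ?orbT.
Qed.

Lemma node_local_succ : node_local g b.+1.
Proof.
apply: (node_local_subv basisB) => j.
case: spreadV => _ _ /fin_all_exists[cov Vcov].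
have [u Vj'u] := spread_notin j.
exists (cov u |: [set cov (g j i + u) | i : 'I_b]); split.
- rewrite in_setU1; apply/norP; split; first by apply: contraNneq Vj'u => ->.
  apply/imsetP => -[i _ jE]; have := Vcov (g j i + u); rewrite -jE.
  by rewrite rpredDl ?g_in // (negPf Vj'u).
- rewrite cardsU1 (leq_add (leq_b1 _)) //.
  by apply: leq_trans (leq_imset_card _ _) _; rewrite card_ord.
rewrite -(span_basis (basisB j)); apply/span_subvP => _ /tnthP[i ->].
rewrite -/(g j i) -[g j i](addrK u).
apply: rpredB; apply: mem_sumv_spread (Vcov _).
  by rewrite in_setU1 imset_f ?orbT.
by rewrite setU11.
Qed.

End SpreadCodes.

Section LLines.
Variables (F : fieldType) (L : fieldExtType F) (m : nat).
Local Notation W := {ffun 'I_m -> L}.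
Implicit Types (w x : W) (c : L).

Definition lscale w c : W := [ffun k => c * w k].

Fact lscale_is_linear w : linear (lscale w).
Proof. by move=> a c c'; apply/ffunP => k; rewrite !ffunE mulrDl scalerAl. Qed.

HB.instance Definition _ w := GRing.isSemilinear.Build F L W _ (lscale w)
  (GRing.semilinear_linear (lscale_is_linear w)).

Definition lline w : {vspace W} := limg (linfun (lscale w)).

Definition deltaw (i : 'I_m) : W := [ffun k => (k == i)%:R].

Lemma deltaw_neq (i k : 'I_m) : k != i -> deltaw i k = 0.
Proof. by move/negPf => ki; rewrite ffunE ki. Qed.

Lemma deltaw_id (i : 'I_m) : deltaw i i = 1.
Proof. by rewrite ffunE eqxx. Qed.

Lemma deltaw_neq0 (i : 'I_m) : deltaw i != 0.
Proof. by apply/eqP => /ffunP/(_ i)/eqP; rewrite deltaw_id ffunE oner_eq0. Qed.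

Lemma llineP w x : reflect (exists c, x = lscale w c) (x \in lline w).
Proof.
apply: (iffP memv_imgP) => [[c _ ->]|[c ->]]; exists c; rewrite ?lfunE ?memvf //.
Qed.

Lemma lline_id w : w \in lline w.
Proof. by apply/llineP; exists 1; apply/ffunP => k; rewrite ffunE mul1r. Qed.

Lemma lscale_eq0 w c : (lscale w c == 0) = (c == 0) || (w == 0).
Proof.
have [->|c_neq0] /= := eqVneq c 0.
  by apply/eqP/ffunP => k; rewrite !ffunE mul0r.
apply/eqP/eqP => [/ffunP wc0 | ->]; apply/ffunP => k; rewrite !ffunE ?mulr0 //.
by have /eqP := wc0 k; rewrite !ffunE mulf_eq0 (negPf c_neq0) => /eqP.
Qed.

Lemma lline_support w x k : x != 0 -> x \in lline w -> (x k == 0) = (w k == 0).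
Proof.
move=> + /llineP[c xE]; rewrite xE lscale_eq0 negb_or => /andP[c_neq0 _].
by rewrite ffunE mulf_eq0 (negPf c_neq0).
Qed.

Lemma dim_lline w : w != 0 -> \dim (lline w) = \dim {:L}.
Proof.
move=> w_neq0; rewrite limg_dim_eq //; apply/eqP; rewrite -subv0.
apply/subvP => c; rewrite memv_cap memv_ker lfunE memv0 lscale_eq0 (negPf w_neq0).
by rewrite orbF => /andP[].
Qed.

Lemma lline_eq w x : x != 0 -> x \in lline w -> lline x = lline w.
Proof.
move=> x_neq0 /llineP[c xE]; move: x_neq0; rewrite xE lscale_eq0 negb_or.
case/andP => c_neq0 _; apply/eqP; rewrite eqEsubv; apply/andP; split.
  apply/subvP => _ /llineP[d ->]; apply/llineP; exists (d * c).
  by apply/ffunP => k; rewrite !ffunE mulrA.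
apply/subvP => _ /llineP[d ->]; apply/llineP; exists (d / c).
by apply/ffunP => k; rewrite !ffunE mulrA divfK.
Qed.

Lemma sumv_lline_delta : (\sum_i lline (deltaw i))%VS = fullv.
Proof.
apply/vspaceP => z; rewrite memvf; apply/memv_sumP.
exists (fun i => lscale (deltaw i) (z i)) => [i _|]; first by apply/llineP; exists (z i).
apply/ffunP => k; rewrite sum_ffunE (bigD1 k) //= !ffunE eqxx mulr1 big1 ?addr0 //.
by move=> i /negPf ik; rewrite !ffunE eq_sym ik mulr0.
Qed.

(* If w lies on the coordinate line of i0, replace that line by the one
   through deltaw i0 + deltaw i1: the lines still span and all miss w. *)
Lemma lline_cover_avoiding w : w != 0 -> (1 < m)%N ->
  exists y : 'I_m -> W, [/\ forall t, y t != 0, forall t, w \notin lline (y t)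
                          & (\sum_t lline (y t))%VS = fullv].
Proof.
move=> w_neq0 m_gt1.
have [/existsP[i0 w_i0] | /existsPn w_delta] := boolP [exists i, w \in lline (deltaw i)].
  have [i1 i10] : exists i1 : 'I_m, i1 != i0.
    have [->|i0_neq] := eqVneq i0 (Ordinal m_gt1).
      by exists (Ordinal (ltnW m_gt1)).
    by exists (Ordinal m_gt1); rewrite eq_sym.
  pose y t := if t == i0 then deltaw i0 + deltaw i1 else deltaw t.
  pose kt t := if t == i0 then i1 else t.
  have kt_neq t : kt t != i0 by rewrite /kt; case: ifP => // /negbT.
  have y_kt t : y t (kt t) = 1.
    rewrite /y /kt; case: eqP => _; rewrite ?deltaw_id //.
    by rewrite ffunE deltaw_id deltaw_neq // add0r.
  have y_neq0 t : y t != 0.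
    by apply: contraTneq (oner_neq0 L) => yt0; rewrite -(y_kt t) yt0 ffunE eqxx.
  exists y; split => // [t|].
    apply: contraTN (w_i0) => /(lline_support (kt t) w_neq0).
    rewrite y_kt oner_eq0 => w_kt; apply/negP => /(lline_support (kt t) w_neq0).
    by rewrite deltaw_neq // eqxx w_kt.
  apply/eqP; rewrite eqEsubv subvf -sumv_lline_delta; apply/subv_sumP => t _.
  have [->|ti0] := eqVneq t i0; last by apply: (sumv_sup t); rewrite // /y (negPf ti0).
  apply/subvP => _ /llineP[c ->]; rewrite (_ : lscale _ _ = lscale (y i0) c - lscale (y i1) c).
    by apply: rpredB; apply: (subvP (sumv_sup _ isT (subvv _))); apply/llineP; exists c.
  by apply/ffunP => k; rewrite /y eqxx (negPf i10) !ffunE mulrDr addrK.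
by exists (@deltaw); split; [exact: deltaw_neq0 | exact: w_delta | exact: sumv_lline_delta].
Qed.

End LLines.

Section SpreadOfPartition.
Variables (F : finFieldType) (M b : nat) (sp : 'rV[F]_M -> {vspace 'rV[F]_M}).
Hypothesis M_gt0 : (0 < M)%N.
Hypothesis mem_sp : forall v, v \in sp v.
Hypothesis dim_sp : forall v, v != 0 -> \dim (sp v) = b.
Hypothesis sp_eq : forall v x, x != 0 -> x \in sp v -> sp x = sp v.

Definition spread_seq := undup [seq sp v | v <- enum 'rV[F]_M & v != 0].

Definition spread_of (j : 'I_(size spread_seq)) := nth 0%VS spread_seq j.

Lemma spread_ofP j : exists2 v, v != 0 & spread_of j = sp v.
Proof.
have := mem_nth 0%VS (ltn_ord j); rewrite mem_undup => /mapP[v].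
by rewrite mem_filter => /andP[v_neq0 _] spE; exists v.
Qed.

Lemma spread_of_sp v : v != 0 -> exists j, spread_of j = sp v.
Proof.
move=> v_neq0; have sp_in : sp v \in spread_seq.
  by rewrite mem_undup; apply: map_f; rewrite mem_filter v_neq0 mem_enum.
have lt_sp : (index (sp v) spread_seq < size spread_seq)%N by rewrite index_mem.
by exists (Ordinal lt_sp); apply: nth_index.
Qed.

Lemma spread_of_is_spread : is_spread_family b spread_of.
Proof.
split=> [j | i j | v].
- by have [v v_neq0 ->] := spread_ofP j; apply: dim_sp.
- apply: contraNeq; rewrite -vpick0; set x := vpick _ => x_neq0.
  have /andP[xi xj] : (x \in spread_of i) && (x \in spread_of j).
    by rewrite -memv_cap memv_pick.
  have [v _ iE] := spread_ofP i; have [w _ jE] := spread_ofP j.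
  rewrite iE in xi; rewrite jE in xj.
  have : spread_of i = spread_of j by rewrite iE jE -(sp_eq x_neq0 xi) (sp_eq x_neq0 xj).
  by move/eqP; rewrite nth_uniq ?undup_uniq.
have [->|v_neq0] := eqVneq v 0; last first.
  by have [j jE] := spread_of_sp v_neq0; exists j; rewrite jE.
have : delta_mx 0 (Ordinal M_gt0) != 0 :> 'rV[F]_M.
  by apply/eqP => /matrixP/(_ 0 (Ordinal M_gt0)); rewrite !mxE eqxx; apply/eqP/oner_neq0.
by case/spread_of_sp => j _; exists j; rewrite mem0v.
Qed.
End SpreadOfPartition.
Arguments spread_of {F M} sp j.
Arguments spread_ofP {F M} sp j.

Lemma dim_ffun_vect (F : fieldType) (vT : vectType F) (m : nat) :
  \dim {:{ffun 'I_m -> vT}} = (m * \dim {:vT})%N.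
Proof. by rewrite !dimvf /dim /= card_ord. Qed.

Section DesarguesianSpread.
Import passmx.
Variables (F : finFieldType) (L : fieldExtType F) (m : nat).
Hypothesis m_gt1 : (1 < m)%N.
Local Notation W := {ffun 'I_m -> L}.
Local Notation d := (\dim {:W}).
Let e := vbasis (fullv : {vspace W}).
Let e_basis : basis_of fullv e := vbasisP fullv.
Let rVofK : cancel (rVof e) (vecof e) := rVofK e_basis.
Let vecofK : cancel (vecof e) (rVof e) := vecofK e_basis.
Let vecof_eq0 v : (vecof e v == 0) = (v == 0) := vecof_eq0 e_basis v.
Let coordf := linfun (rVof e).

Definition dline (v : 'rV[F]_d) : {vspace 'rV[F]_d} := (coordf @: lline (vecof e v))%VS.

Let dline_rVof w : dline (rVof e w) = (coordf @: lline w)%VS.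
Proof. by rewrite /dline rVofK. Qed.

Let mem_dline v w : (v \in coordf @: lline w)%VS = (vecof e v \in lline w).
Proof.
apply/idP/idP => [/memv_imgP[u uw ->] | vw]; first by rewrite lfunE /= rVofK.
by apply/memv_imgP; exists (vecof e v); rewrite ?lfunE /= ?vecofK.
Qed.

Lemma dline_id v : v \in dline v.
Proof. by rewrite mem_dline lline_id. Qed.

Lemma dim_dline v : v != 0 -> \dim (dline v) = \dim {:L}.
Proof.
move=> v_neq0; rewrite /dline limg_dim_eq ?dim_lline ?vecof_eq0 //.
have /eqP-> : lker coordf == 0%VS.
  by apply/lker0P => x y; rewrite !lfunE; apply: (can_inj rVofK).
exact: capv0.
Qed.

Lemma dline_eq v x : x != 0 -> x \in dline v -> dline x = dline v.
Proof.
by move=> x_neq0 /[!mem_dline] xv; rewrite /dline (lline_eq _ xv) // vecof_eq0.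
Qed.

Lemma dline_cover_avoiding v : v != 0 ->
  exists y : 'I_m -> 'rV[F]_d, [/\ forall t, y t != 0, forall t, v \notin dline (y t)
                                 & (dline v <= \sum_t dline (y t))%VS].
Proof.
rewrite -vecof_eq0 => /lline_cover_avoiding/(_ m_gt1)[y [y_neq0 v'y sum_y]].
exists (fun t => rVof e (y t)); split=> [t | t |].
- by rewrite rVof_eq0.
- by rewrite dline_rVof mem_dline.
rewrite (eq_bigr _ (fun t _ => dline_rVof (y t))) -limg_sum sum_y.
exact: limgS (subvf _).
Qed.

Lemma desarguesian_spread : exists n (V : 'I_n -> {vspace 'rV[F]_d}),
  is_spread_family (\dim {:L}) V /\
  forall j, exists S : {set 'I_n}, [/\ j \notin S, (#|S| <= m)%N & (V j <= \sum_(k in S) V k)%VS].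
Proof.
have d_gt0 : (0 < d)%N by rewrite dim_ffun_vect muln_gt0 adim_gt0 ltnW.
exists (size (spread_seq dline)), (spread_of dline).
split=> [|j]; first exact: spread_of_is_spread d_gt0 dline_id dim_dline dline_eq.
have [v v_neq0 jE] := spread_ofP dline j.
have [y [y_neq0 v'y sum_y]] := dline_cover_avoiding v_neq0.
have [k kE] := fin_all_exists (fun t => spread_of_sp dline (y_neq0 t)).
exists [set k t | t : 'I_m]; split.
- apply/imsetP => -[t _ jt]; have := dline_id v.
  by rewrite -jE jt kE (negPf (v'y t)).
- by apply: leq_trans (leq_imset_card _ _) _; rewrite card_ord.
rewrite jE; apply: subv_trans sum_y _; apply/subv_sumP => t _.
by apply: (sumv_sup (k t)); rewrite ?imset_f ?kE.
Qed.

End DesarguesianSpread.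

(* L is the splitting field of X^(q^k) - X: its q^k roots are distinct and,
   being the fixed points of the k-th power of Frobenius, form all of L. *)
Lemma ex_fieldExt_card (F : finFieldType) (k : nat) : (0 < k)%N ->
  exists L : fieldExtType F, #|finvect_type L| = (#|F| ^ k)%N.
Proof.
move=> k_gt0; pose q := #|F|; pose m := (q ^ k)%N.
have q_gt1 : (1 < q)%N := finNzRing_gt1 F.
have m_gt1: (m > 1)%N by rewrite (ltn_exp2l 0).
have m_gt0 := ltnW m_gt1; have m1_gt0: (m.-1 > 0)%N by rewrite -ltnS prednK.
pose pq (R : nzRingType) : {poly R} := 'X^m - 'X.
have Dq R: pq R = ('X^(m.-1) - 1) * ('X - 0).
  by rewrite subr0 mulrBl mul1r -exprSr prednK.
have /FinSplittingFieldFor[/= L splitLq]: pq F != 0.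
  by rewrite Dq monic_neq0 ?rpredM ?monicXsubC ?monicXnsubC.
rewrite rmorphB rmorphXn /= map_polyX -/(pq L) in splitLq.
have [p pr_p pcharFp] := finPcharP F.
have pcharL: p \in [pchar L] by rewrite pchar_lalg.
have mL0 : (m%:R : L) = 0.
  have Eq : q = (p ^ logn p q)%N := card_pprimeChar pcharFp.
  have lg : (0 < logn p q)%N.
    by rewrite lt0n; apply/eqP => l0; move: q_gt1; rewrite Eq l0.
  by rewrite /m Eq -expnM natrX pcharf0 // expr0n muln_eq0 !eqn0Ngt lg k_gt0.
have /finField_galois_generator[/= a _ Da]: (1 <= {:L})%VS by apply: sub1v.
pose Em := fixedSpace (a ^+ k)%g; rewrite dimv1 expn1 in Da.
have{splitLq} [zs DqL defL] := splitLq.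
have Uzs: uniq zs.
  rewrite -separable_prod_XsubC -(eqp_separable DqL) Dq separable_root andbC.
  rewrite /root !hornerE subr_eq0 eq_sym expr0n gtn_eqF ?oner_eq0 //=.
  rewrite cyclotomic.separable_Xn_sub_1 // -subn1 natrB // subr_eq0.
  by rewrite mL0 eq_sym oner_eq0.
exists L; suffices /eq_card->: finvect_type L =i zs.
  apply: succn_inj; rewrite (card_uniqP _) //= -(size_prod_XsubC _ id).
  by rewrite -(eqp_size DqL) size_polyDl size_polyXn // size_polyN size_polyX.
have in_zs: zs =i Em.
  move=> z; rewrite -root_prod_XsubC -(eqp_root DqL) (sameP fixedSpaceP eqP).
  rewrite /root !hornerE subr_eq0 /= /m; congr (_ == z).
  elim: (k) => [|i IHi]; first by rewrite gal_id.
  by rewrite expgSr expnSr exprM IHi galM ?Da ?memvf.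
suffices defEm: Em = {:L}%VS by move=> z; rewrite in_zs defEm memvf.
apply/eqP; rewrite eqEsubv subvf -defL -[Em]subfield_closed agenvS //.
by rewrite subv_add sub1v; apply/span_subvP=> z; rewrite in_zs.
Qed.

Lemma ex_fieldExt_dim (F : finFieldType) (k : nat) : (0 < k)%N ->
  exists L : fieldExtType F, \dim {:L} = k.
Proof.
move=> /(ex_fieldExt_card F)[L cardL]; exists L; apply/eqP.
rewrite -(eqn_exp2l _ _ (finNzRing_gt1 F)) -cardL.
by have := card_vspace (fullv : {vspace finvect_type L}); rewrite card_vspacef => ->.
Qed.

Theorem mainTheorem8 (F : finFieldType) (M b : nat) :
  (b %| M)%N -> (b < M)%N ->
  (forall (n : nat) (V : 'I_n -> {vspace 'rV[F]_M})
          (B : 'I_n -> b.-tuple 'rV[F]_M),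
      is_spread_family b V ->
      (forall j, basis_of (V j) (B j)) ->
      let g := fun j i => tnth (B j) i in
      symbol_locality g 2 /\
      exists rn, node_locality g rn /\ (2 <= rn <= b.+1)%N) /\
  (exists (n : nat) (V : 'I_n -> {vspace 'rV[F]_M}),
      is_spread_family b V /\
      forall B : 'I_n -> b.-tuple 'rV[F]_M,
        (forall j, basis_of (V j) (B j)) ->
        exists rn, node_locality (fun j i => tnth (B j) i) rn /\ (rn <= M %/ b)%N).
Proof.
move=> b_dvd_M ltn_bM.
have b_gt0 : (0 < b)%N by case: b b_dvd_M ltn_bM => // /[!dvd0n] /eqP->.
split=> [n V B spreadV basisB g|].
  have ge2 := symbol_local_ge2 basisB spreadV b_gt0.
  split; first by split; [exact: symbol_local2 | exact: ge2].
  have [rn loc_rn le_rn] := ex_node_locality (node_local_succ basisB spreadV ltn_bM).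
  exists rn; split=> //; rewrite le_rn andbT.
  by apply/ge2/node_local_symbol_local; case: loc_rn.
have [m Mdef] := dvdnP b_dvd_M.
have m_gt1 : (1 < m)%N by rewrite -(ltn_pmul2r b_gt0) -Mdef mul1n.
have [L dimL] := ex_fieldExt_dim F b_gt0.
have dimW : \dim {:{ffun 'I_m -> L}} = M by rewrite dim_ffun_vect dimL Mdef.
have -> : (M %/ b = m)%N by rewrite Mdef mulnK.
clear Mdef; subst M.
have [n [V [spreadV locV]]] := desarguesian_spread L m_gt1.
rewrite dimL in spreadV; exists n, V; split=> // B basisB.
have [rn loc_rn le_rn] := ex_node_locality (node_local_subv basisB locV).
by exists rn.
Qed.
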